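(* For $\theta\in(0,\pi)\setminus\Theta_F$ define the Hermitian Maass–Selberg logarithmic-derivative matrix $$\mathcal M(\theta)=iS_\theta^*\dot S_\theta,\qquad \dot S_\theta=\partial_\theta S(e^{i\theta}),$$ and its traceless part $$\mathcal M_0(\theta)=\mathcal M(\theta)-\frac1r\operatorname{tr}\mathcal M(\theta)\,I_r.$$ Then $\mathcal M(\theta)$ is recovered from any truncated Gram matrix $\Psi_\theta^*P_N\Psi_\theta$ ($N\ge1$) after subtracting the universal term and the boundary terms, that is, $$\mathcal M(\theta)=\Psi_\theta^*P_N\Psi_\theta-(2N+1)I_r-\frac{i}{2\sin\theta}\left(e^{-i(2N+1)\theta}S_\theta-e^{i(2N+1)\theta}S_\theta^*\right).$$ It also has the averaged form $$\mathcal M(\theta)=\lim_{L\to\infty}\frac1L\sum_{N=1}^L\left\{\Psi_\theta^*P_N\Psi_\theta-(2N+1)I_r\right\},$$ where the limit is taken in $M_r(\mathbb C)$. Locally on the unitary axis, $$\operatorname{tr}\mathcal M(\theta)=i\,\partial_\theta\log\det S_\theta .$$ Thus $\det S_\theta$ determines only the trace of $\mathcal M(\theta)$. For $r\ge2$, it does not in general determine $\mathcal M_0(\theta)$, which retains the channel-resolved finite term in the truncated Gram matrix; for $r=1$, the traceless part is zero.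
   Context: Let $q$ be a prime power, $a=\sqrt q$, $d,r\ge1$ integers, $H_C=H_C^*$ a complex $d\times d$ matrix, and $V:\mathbb C^r\to\mathbb C^d$ linear. Let $\mathscr H=\mathbb C^d\oplus\bigoplus_{c=1}^r\ell^2(\mathbb N)$, $\mathbb N=\{1,2,\dots\}$; write elements as $(u,g)$ with $g(n)=(g_1(n),\dots,g_r(n))^t\in\mathbb C^r$. The summand $\mathbb C^d$ is the finite core and the $r$ summands $\ell^2(\mathbb N)$ are the tails (channels). The bounded self-adjoint operator $J$ is $J(u,g)=(H_Cu+Vg(1),\,h)$, where $h(1)=a\,g(2)+V^*u$ and $h(n)=a\{g(n-1)+g(n+1)\}$ for $n\ge2$. For $\zeta\in\mathbb C^\times$ put $x(\zeta)=a(\zeta+\zeta^{-1})$, $$F(\zeta)=H_C-x(\zeta)I_d+\frac{\zeta^{-1}}{a}VV^*,\qquad S(\zeta)=-I_r+\frac{\zeta^{-1}-\zeta}{a}V^*F(\zeta)^{-1}V,$$ and for $\alpha\in\mathbb C^r$ $$\Psi(\zeta)\alpha=\Bigl((\zeta^{-1}-\zeta)F(\zeta)^{-1}V\alpha,\ \bigl(\zeta^n\alpha+\zeta^{-n}S(\zeta)\alpha\bigr)_{n\ge1}\Bigr),$$ a generalized eigenfunction of $J$ at $x(\zeta)$. Let $\Theta_F=\{\theta\in(0,\pi):\det F(e^{i\theta})=0\}$, a finite set. For $\theta\in(0,\pi)\setminus\Theta_F$ write $S_\theta=S(e^{i\theta})$ (a unitary matrix) and $\Psi_\theta=\Psi(e^{i\theta})$.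 For $N\ge1$, $P_N$ is the coordinate projection onto the finite core $\mathbb C^d$ and the coordinates $1,\dots,N$ of every tail. $\Psi_\theta^*P_N\Psi_\theta$ is the $r\times r$ matrix with $(c,c')$ entry $\langle P_N\Psi_\theta e_{c'},\Psi_\theta e_c\rangle$ (a finite sum), with inner products linear in the first variable and $e_c$ the standard vectors of $\mathbb C^r$. $M_r(\mathbb C)$ denotes the $r\times r$ complex matrices. *)

(* Defs.v *)
From HB Require Import structures.
From mathcomp Require Import all_boot all_order all_algebra.
From mathcomp Require Import complex.
From mathcomp Require Import all_classical all_reals all_analysis.

Set Implicit Arguments.
Unset Strict Implicit.
Unset Printing Implicit Defensive.

Import Order.TTheory GRing.Theory Num.Theory numFieldNormedType.Exports.

Local Open Scope classical_set_scope.
Local Open Scope ring_scope.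
Local Open Scope sesquilinear_scope.

(* [R[i]] carries no canonical topology in MathComp-Analysis, but every
   [numClosedFieldType] does (that of its norm), and so do the matrix spaces
   over it.  Viewing [R[i]] through this constant makes these inferable. *)
Definition Cx (R : realType) : numClosedFieldType := R[i].

Definition toC {R : realType} (x : R) : Cx R := (x%:C)%C.

(* e^{it} *)
Definition expi {R : realType} (t : R) : Cx R := (cos t +i* sin t)%C.

Definition cexp {R : realType} (z : Cx R) : Cx R :=
  toC (expR (complex.Re z)) * expi (complex.Im z).

(* The library's derivatives require the scalars of the target space to be the
   domain of the function; here the variable is real and the scalars complex. *)
Definition diff_quotient {R : realType} {W : normedModType (Cx R)}
    (f : R -> W) (t h : R) : W :=
  (toC h)^-1 *: (f (t + h) - f t).

Definition tderivable {R : realType} {W : normedModType (Cx R)}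
    (f : R -> W) (t : R) : Prop :=
  cvg (diff_quotient f t h @[h --> (0 : R)^']).

Definition tderive {R : realType} {W : normedModType (Cx R)}
    (f : R -> W) (t : R) : W :=
  lim (diff_quotient f t h @[h --> (0 : R)^']).

(* l is a continuous branch of log f on a neighbourhood of t *)
Definition is_log_branch {R : realType} (l f : R -> Cx R) (t : R) : Prop :=
  \forall s \near t, {for s, continuous l} /\ cexp (l s) = f s.

Definition is_prime_power (q : nat) : Prop :=
  exists p k : nat, [/\ prime p, (0 < k)%N & q = (p ^ k)%N].

(* The parameter a = sqrt q. *)
Definition aq (R : realType) (q : nat) : Cx R := toC (Num.sqrt (q%:R : R)).

Definition xq {R : realType} (q : nat) (zeta : Cx R) : Cx R :=
  aq R q * (zeta + zeta^-1).

Definition Fmx {R : realType} (q d r : nat)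
    (H : 'M[Cx R]_d) (V : 'M[Cx R]_(d, r)) (zeta : Cx R) : 'M[Cx R]_d :=
  H - (xq q zeta)%:M + (zeta^-1 / aq R q) *: (V *m V ^t*).

Definition Smx {R : realType} (q d r : nat)
    (H : 'M[Cx R]_d) (V : 'M[Cx R]_(d, r)) (zeta : Cx R) : 'M[Cx R]_r :=
  - 1%:M + ((zeta^-1 - zeta) / aq R q) *:
             (V ^t* *m invmx (Fmx q H V zeta) *m V).

(* A pair (u, g) with g : nat -> C^r, where g n = (g_1(n), ..., g_r(n))^t for
   n >= 1; the tails are indexed by {1, 2, ...} and g 0 is never used.  No
   summability is imposed, since generalized eigenfunctions are not in l^2. *)
Definition state (R : realType) (d r : nat) : Type :=
  ('cV[Cx R]_d * (nat -> 'cV[Cx R]_r))%type.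

Definition Psi {R : realType} (q d r : nat)
    (H : 'M[Cx R]_d) (V : 'M[Cx R]_(d, r)) (zeta : Cx R)
    (alpha : 'cV[Cx R]_r) : state R d r :=
  ((zeta^-1 - zeta) *: (invmx (Fmx q H V zeta) *m V *m alpha),
   fun n => zeta ^+ n *: alpha + zeta ^- n *: (Smx q H V zeta *m alpha)).

Definition PN {R : realType} (d r N : nat) (w : state R d r) : state R d r :=
  (w.1, fun n => if (1 <= n <= N)%N then w.2 n else 0).

(* Linear in the first variable. *)
Definition dotc {R : realType} (n : nat) (u v : 'cV[Cx R]_n) : Cx R :=
  \sum_(i < n) u i 0 * (v i 0)^*.

(* The inner product of the Hilbert space; the series over the tails is a
   finite sum as soon as one argument is in the range of some PN. *)
Definition inner {R : realType} (d r : nat) (w w' : state R d r) : Cx R :=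
  dotc w.1 w'.1 + limn (fun K => \sum_(1 <= n < K) dotc (w.2 n) (w'.2 n)).

Definition Theta_F {R : realType} (q d r : nat)
    (H : 'M[Cx R]_d) (V : 'M[Cx R]_(d, r)) : set R :=
  [set t | 0 < t < pi /\ \det (Fmx q H V (expi t)) = 0].

Definition regular_angles {R : realType} (q d r : nat)
    (H : 'M[Cx R]_d) (V : 'M[Cx R]_(d, r)) : set R :=
  [set t | 0 < t < pi] `\` Theta_F q H V.

Definition Sth {R : realType} (q d r : nat)
    (H : 'M[Cx R]_d) (V : 'M[Cx R]_(d, r)) (t : R) : 'M[Cx R]_r :=
  Smx q H V (expi t).

(* Psi_t^* P_N Psi_t *)
Definition gram {R : realType} (q d r : nat)
    (H : 'M[Cx R]_d) (V : 'M[Cx R]_(d, r)) (t : R) (N : nat) : 'M[Cx R]_r :=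
  \matrix_(c, c') inner (PN N (Psi q H V (expi t) (delta_mx c' 0)))
                        (Psi q H V (expi t) (delta_mx c 0)).

Definition MS {R : realType} (q d r : nat)
    (H : 'M[Cx R]_d) (V : 'M[Cx R]_(d, r)) (t : R) : 'M[Cx R]_r :=
  'i *: ((Sth q H V t) ^t* *m tderive (Sth q H V) t).

Definition traceless {R : realType} (r : nat) (A : 'M[Cx R]_r) : 'M[Cx R]_r :=
  A - (r%:R^-1 * \tr A)%:M.

Definition MS0 {R : realType} (q d r : nat)
    (H : 'M[Cx R]_d) (V : 'M[Cx R]_(d, r)) (t : R) : 'M[Cx R]_r :=
  traceless (MS q H V t).

Definition boundary {R : realType} (q d r : nat)
    (H : 'M[Cx R]_d) (V : 'M[Cx R]_(d, r)) (t : R) (N : nat) : 'M[Cx R]_r :=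
  ('i / toC (2 * sin t)) *:
    (expi (- ((2 * N + 1)%:R * t)) *: Sth q H V t
     - expi ((2 * N + 1)%:R * t) *: (Sth q H V t) ^t*).

(* Main.v *)
(* With G = F^-1, X = V^* G V, Y = V^* G^* V, Z = V^* G^* G V and k = (z^-1 - z) / a, the relation
   F - F^* = k V V^* on the unit circle gives k Y X = Y - X and S^* V^* G = - V^* G^*.  Hence S is
   unitary, and differentiating F^-1 turns i S^* S' into
     M = - (z^-1 - z)^2 Z - (z^-1 X + z Y) / a,
   which is visibly Hermitian.  The first term is the core part of the Gram matrix; the tails
   contribute 2 N plus geometric sums of z^(-2n) S and z^(2n) S^*, whose lower ends amount to
   1 - (z^-1 X + z Y) / a and whose upper ends form the boundary matrix.  The boundary matrix oscillates in N, so its Cesaro means vanish.  Jacobi's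
   formula gives the trace.  Coupling a single channel j to a scalar core leaves det S independent
   of j while M is a multiple of the matrix unit E_jj, so det S does not see M_0. *)
Require Import Defs.
From HB Require Import structures.
From mathcomp Require Import all_boot all_order all_algebra.
From mathcomp Require Import perm complex.
From mathcomp Require Import all_classical all_reals all_analysis.
From mathcomp Require Import ring.

Set Implicit Arguments.
Unset Strict Implicit.
Unset Printing Implicit Defensive.

Import Order.TTheory GRing.Theory Num.Theory numFieldNormedType.Exports.

Local Open Scope classical_set_scope.
Local Open Scope ring_scope.
Local Open Scope sesquilinear_scope.

(** Solves the product rule for [invmx A *m A = 1%:M] for the derivative [D] of the inverse, where
    [B] stands for the derivative of [A]. *)
Lemma invmx_derivative_eq (F : fieldType) n (A B D : 'M[F]_n) :
  A \in unitmx -> D *m A + invmx A *m B = 0 -> D = - (invmx A *m B *m invmx A).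
Proof.
move=> uA /(congr1 (mulmx^~ (invmx A))).
by rewrite mul0mx mulmxDl (mulmxK uA) => /eqP; rewrite addr_eq0 => /eqP.
Qed.

(** * Derivatives in a real variable of complex-valued and complex matrix-valued functions *)

Section Calculus.
Context {R : realType}.
Implicit Types (t : R) (f g : R -> Cx R).

Lemma toC_lt (x y : R) : (toC x < toC y) = (x < y).
Proof. exact: ltcR. Qed.

Lemma toC_norm (x : R) : `|toC x| = toC `|x|.
Proof. by rewrite /toC normc_def /= expr0n addr0 sqrtr_sqr. Qed.

Lemma toCE (x : R) : toC x = real_complex R x. Proof. by []. Qed.

(** The order on [Cx R] compares only numbers with equal imaginary parts, so positivity forces a
    real number. This turns every epsilon in [Cx R] into a real one. *)
Lemma posC_toC (e : Cx R) : 0 < e -> exists2 x : R, 0 < x & e = toC x.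
Proof.
case: e => a b; rewrite (@ltcE R) /= => /andP[/eqP -> a0]; by exists a.
Qed.

Lemma toC_cvg T (F : set_system T) {FF : Filter F} (f : T -> R) (l : R) :
  f x @[x --> F] --> l -> toC (f x) @[x --> F] --> toC l.
Proof.
move=> fl; apply/cvgrPdist_lt => e /posC_toC[x x0 ->].
have /cvgrPdist_lt/(_ _ x0) := fl; apply: filterS => y.
by rewrite !toCE -rmorphB -toCE toC_norm toC_lt.
Qed.

Lemma Re_cvg T (F : set_system T) {FF : Filter F} (f : T -> Cx R) (l : Cx R) :
  f x @[x --> F] --> l -> complex.Re (f x) @[x --> F] --> complex.Re l.
Proof.
move=> fl; apply/cvgrPdist_lt => e e0.
have /cvgrPdist_lt/(_ (toC e)) := fl; rewrite toC_lt => /(_ e0).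
apply: filterS => y h; rewrite -toC_lt; apply: le_lt_trans h.
have -> : complex.Re l - complex.Re (f y) = complex.Re (l - f y).
  by case: l fl (f y) => ? ? _ [].
exact: normc_ge_Re.
Qed.

Lemma Im_cvg T (F : set_system T) {FF : Filter F} (f : T -> Cx R) (l : Cx R) :
  f x @[x --> F] --> l -> complex.Im (f x) @[x --> F] --> complex.Im l.
Proof.
move=> fl; have ImE (z : Cx R) : complex.Im z = complex.Re (- 'i * z).
  by case: z => a b; rewrite -complexiE /= oppr0 mul0r mulN1r sub0r opprK.
rewrite ImE (_ : (fun x => _) = fun x => complex.Re (- 'i * f x)); last first.
  by apply/funext => x; exact: ImE.
exact: (Re_cvg (cvgM (cvg_cst (- 'i : Cx R)) fl)).
Qed.

Lemma cvg_near_ext T (F : set_system T) {FF : Filter F} (U : topologicalType)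
    (f g : T -> U) (l : U) :
  (\forall x \near F, f x = g x) -> f x @[x --> F] --> l -> g x @[x --> F] --> l.
Proof.
move=> fg; apply: cvg_trans; apply: near_eq_cvg.
by apply: filterS fg => x ->.
Qed.

(** A neighbourhood of a matrix contains a product of neighbourhoods of its entries, and a filter is
    stable under the finite intersection over these entries. *)
Lemma mx_cvg T (F : set_system T) {FF : Filter F} m n
    (f : T -> 'M[Cx R]_(m, n)) (l : 'M[Cx R]_(m, n)) :
  (forall i j, f x i j @[x --> F] --> l i j) -> f x @[x --> F] --> l.
Proof.
move=> fl A [P Pl PA].
have /(@filter_forall _ 'I_m) : forall i, \forall x \near F, forall j, P i j (f x i j).
  by move=> i; apply: filter_forall => j; exact: (fl _ _ _ (Pl i j)).
by apply: filterS => x h; exact: PA.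
Qed.

(** The relational form carries existence and value together, so that the differentiation rules
    compose without side conditions on derivability. *)
Definition has_tderive (W : normedModType (Cx R)) (f : R -> W) t (l : W) : Prop :=
  diff_quotient f t h @[h --> (0 : R)^'] --> l.

Lemma has_tderiveE (W : normedModType (Cx R)) (f : R -> W) t l :
  has_tderive f t l -> tderivable f t /\ tderive f t = l.
Proof.
by move=> h; split; [apply: cvgP h | apply: cvg_lim h; exact: norm_hausdorff].
Qed.

Lemma near_dnbhs_shift (P : R -> Prop) t :
  (\forall s \near t, P s) -> \forall h \near (0 : R)^', P (t + h).
Proof.
move=> /nbhs_ballP[e /= e0 he]; apply/nbhs_ballP; exists e => //= h he' _.
apply: he; rewrite /ball /= opprD addrA subrr sub0r normrN.
by move: he'; rewrite /ball /= sub0r normrN.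
Qed.

Lemma has_tderive_near (W : normedModType (Cx R)) (f g : R -> W) t l :
  (\forall s \near t, f s = g s) -> has_tderive g t l -> has_tderive f t l.
Proof.
move=> fg; apply: cvg_trans; apply: near_eq_cvg.
have ft : f t = g t by exact: nbhs_singleton fg.
by have := near_dnbhs_shift fg; apply: filterS => h; rewrite /diff_quotient ft => ->.
Qed.

Lemma toC_cvg0 : toC h @[h --> (0 : R)^'] --> (0 : Cx R).
Proof. by apply: toC_cvg; apply: cvg_within. Qed.

Lemma toC_neq0 (h : R) : h != 0 -> toC h != 0.
Proof. by apply: contra => /eqP[] ->. Qed.

(** Writes f(t + h) as f(t) plus h times the difference quotient. This is continuity along punctured
    neighbourhoods, as the product and inverse rules use it. *)
Lemma has_tderive_shift (W : normedModType (Cx R)) (f : R -> W) t l :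
  has_tderive f t l -> f (t + h) @[h --> (0 : R)^'] --> f t.
Proof.
move=> fl.
have : f t + toC h *: diff_quotient f t h @[h --> (0 : R)^'] --> f t + 0 *: l.
  by apply: cvgD; [exact: cvg_cst | apply: cvgZ => //; exact: toC_cvg0].
rewrite scale0r addr0; apply: cvg_trans; apply: near_eq_cvg.
near=> h; rewrite /diff_quotient scalerA divff ?scale1r ?subrKC //.
by apply: toC_neq0; near: h; exact: nbhs_dnbhs_neq.
Unshelve. all: by end_near. Qed.

Lemma has_tderive_continuous (W : normedModType (Cx R)) (f : R -> W) t l :
  has_tderive f t l -> {for t, continuous f}.
Proof.
move=> /has_tderive_shift ft; apply/continuous_withinNx => A /ft.
move=> /nbhs_ballP[e /= e0 he]; apply/nbhs_ballP; exists e => //= s se st.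
have := he (s - t); rewrite /= subrKC; apply; last by rewrite subr_eq0.
by move: se; rewrite /ball /= sub0r normrN distrC.
Qed.

Lemma has_tderive_cst (W : normedModType (Cx R)) (c : W) t : has_tderive (fun _ => c) t 0.
Proof.
by apply: cvg_near_cst; near=> h; rewrite /diff_quotient subrr scaler0.
Unshelve. all: by end_near. Qed.

Lemma has_tderiveD (W : normedModType (Cx R)) (f g : R -> W) t k l :
  has_tderive f t k -> has_tderive g t l ->
  has_tderive (fun s => f s + g s) t (k + l).
Proof.
move=> fk gl; apply: cvg_near_ext (cvgD fk gl).
by near=> h; rewrite /= /diff_quotient -scalerDr opprD addrACA.
Unshelve. all: by end_near. Qed.

Lemma has_tderiveM f g t k l :
  has_tderive f t k -> has_tderive g t l ->
  has_tderive (fun s => f s * g s) t (k * g t + f t * l).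
Proof.
move=> fk gl.
apply: cvg_near_ext (cvgD (cvgM fk (has_tderive_shift gl)) (cvgM (cvg_cst (f t)) gl)).
near=> h; rewrite /= /diff_quotient /GRing.scale /=; ring.
Unshelve. all: by end_near. Qed.

Lemma has_tderiveMl (c : Cx R) f t l :
  has_tderive f t l -> has_tderive (fun s => c * f s) t (c * l).
Proof.
move=> fl; rewrite -[c * l]add0r -(mul0r (f t)).
exact: has_tderiveM (has_tderive_cst c t) fl.
Qed.

Lemma has_tderiveV f t l : f t != 0 -> has_tderive f t l ->
  has_tderive (fun s => (f s)^-1) t (- l / f t ^+ 2).
Proof.
move=> ft fl; have fs := has_tderive_shift fl.
rewrite expr2 invfM.
apply: cvg_near_ext (cvgM (cvgN fl) (cvgM (cvgV ft fs) (cvg_cst (f t)^-1))).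
near=> h; rewrite /= /diff_quotient /GRing.scale /= /unstable.inv_fun.
have fh : f (t + h) != 0.
  near: h; exact: (cvgr_neq0 _ fs).
have h0 : toC h != 0 by apply: toC_neq0; near: h; exact: nbhs_dnbhs_neq.
rewrite -[(- _) h]/(- ((toC h)^-1 * (f (t + h) - f t))).
by field; rewrite h0 ft fh.
Unshelve. all: by end_near. Qed.

Lemma has_tderive_sum (I : Type) (s : seq I) (P : pred I) (W : normedModType (Cx R))
    (f : I -> R -> W) (f' : I -> W) t :
  (forall i, has_tderive (f i) t (f' i)) ->
  has_tderive (fun x => \sum_(i <- s | P i) f i x) t (\sum_(i <- s | P i) f' i).
Proof.
move=> ff; elim: s => [|i s IH].
  rewrite big_nil; under eq_fun do rewrite big_nil; exact: has_tderive_cst.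
rewrite big_cons; under eq_fun do rewrite big_cons.
by case: ifP => // _; exact: has_tderiveD.
Qed.

(** In a duplicate-free list the condition [j != i] drops exactly one factor, so the Leibniz rule
    takes this form; [has_tderive_det] uses it on each permutation term. *)
Lemma has_tderive_prod (I : eqType) (s : seq I) (f : I -> R -> Cx R) (f' : I -> Cx R) t :
  uniq s -> (forall i, has_tderive (f i) t (f' i)) ->
  has_tderive (fun x => \prod_(i <- s) f i x) t
    (\sum_(i <- s) f' i * \prod_(j <- s | j != i) f j t).
Proof.
move=> + ff; elim: s => [_|i s IH /= /andP[si /IH{}IH]].
  rewrite big_nil; under eq_fun do rewrite big_nil; exact: has_tderive_cst.
under eq_fun do rewrite big_cons.
have := has_tderiveM (ff i) IH; congr has_tderive.
rewrite big_cons big_cons eqxx /=; congr (_ * _ + _).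
  rewrite [LHS]big_seq [RHS]big_seq_cond; apply: eq_bigl => j.
  by have [js|//] := boolP (j \in s); apply/esym; apply: contraNneq si => <-.
rewrite mulr_sumr [LHS]big_seq [RHS]big_seq; apply: eq_bigr => j js.
rewrite big_cons; have -> : i != j by apply: contraNneq si => ->.
by rewrite mulrCA.
Qed.

Lemma has_tderive_mx m n (A : R -> 'M[Cx R]_(m, n)) t (A' : 'M[Cx R]_(m, n)) :
  (forall i j, has_tderive (fun s => A s i j) t (A' i j)) -> has_tderive A t A'.
Proof.
move=> h; apply: mx_cvg => i j; apply: cvg_near_ext (h i j).
by near=> x; rewrite /diff_quotient !mxE.
Unshelve. all: by end_near. Qed.

Lemma has_tderive_coord m n (A : R -> 'M[Cx R]_(m, n)) t (A' : 'M[Cx R]_(m, n)) i j :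
  has_tderive A t A' -> has_tderive (fun s => A s i j) t (A' i j).
Proof.
move=> h.
apply: cvg_near_ext (continuous_cvg _ (@coord_continuous _ _ _ i j A') h).
by near=> x; rewrite /diff_quotient !mxE.
Unshelve. all: by end_near. Qed.

Lemma has_tderive_mulmx m n p (A : R -> 'M[Cx R]_(m, n)) (B : R -> 'M[Cx R]_(n, p)) t
    (A' : 'M[Cx R]_(m, n)) (B' : 'M[Cx R]_(n, p)) :
  has_tderive A t A' -> has_tderive B t B' ->
  has_tderive (fun s => A s *m B s) t (A' *m B t + A t *m B').
Proof.
move=> hA hB; apply: has_tderive_mx => i j; under eq_fun do rewrite mxE.
rewrite !mxE -big_split; apply: has_tderive_sum => k.
by apply: has_tderiveM; exact: has_tderive_coord.
Qed.

Lemma has_tderiveZ m n f (A : R -> 'M[Cx R]_(m, n)) t k (A' : 'M[Cx R]_(m, n)) :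
  has_tderive f t k -> has_tderive A t A' ->
  has_tderive (fun s => f s *: A s) t (k *: A t + f t *: A').
Proof.
move=> hf hA; apply: has_tderive_mx => i j; under eq_fun do rewrite mxE.
rewrite !mxE; exact: has_tderiveM hf (has_tderive_coord hA).
Qed.

(* Jacobi: by multilinearity the derivative is the sum over i of the determinants in which row
   i alone is differentiated; expand these along row i. *)
Lemma has_tderive_det n (A : R -> 'M[Cx R]_n) t (A' : 'M[Cx R]_n) : has_tderive A t A' ->
  has_tderive (fun s => \det (A s)) t (\tr (A' *m \adj (A t))).
Proof.
move=> hA; pose B i := \matrix_(k, l) (if k == i then A' k l else A t k l).
have -> : \tr (A' *m \adj (A t)) = \sum_i \det (B i).
  apply: eq_bigr => i _; rewrite mxE (expand_det_row _ i); apply: eq_bigr => j _.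
  rewrite !mxE eqxx /cofactor; congr (_ * (_ * \det _)).
  by apply/matrixP => k l; rewrite !mxE eq_sym (negbTE (neq_lift _ _)).
rewrite exchange_big /=; apply: has_tderive_sum => s.
rewrite -mulr_sumr; apply: has_tderiveMl.
have := @has_tderive_prod _ (index_enum 'I_n) (fun i x => A x i (s i))
  (fun i => A' i (s i)) t (index_enum_uniq _) (fun i => has_tderive_coord hA).
congr has_tderive; apply: eq_bigr => i _; rewrite [RHS](bigD1 i) //= !mxE eqxx.
by congr (_ * _); apply: eq_bigr => j ji; rewrite mxE (negbTE ji).
Qed.

(** The entries of the adjugate are signed minors, to which Jacobi's formula applies. Existence
    suffices: [has_tderive_invmx] finds the value it needs by another route. *)
Lemma tderivable_adj n (A : R -> 'M[Cx R]_n) t (A' : 'M[Cx R]_n) : has_tderive A t A' ->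
  exists B : 'M[Cx R]_n, has_tderive (fun s => \adj (A s)) t B.
Proof.
move=> hA.
exists (\matrix_(i, j) ((-1) ^+ (j + i) *
  \tr ((row' j (col' i A')) *m \adj (row' j (col' i (A t)))))).
apply: has_tderive_mx => i j; under eq_fun do rewrite mxE.
rewrite mxE; apply: has_tderiveMl; apply: has_tderive_det;
  apply: has_tderive_mx => k l; under eq_fun do rewrite !mxE.
by rewrite !mxE; exact: has_tderive_coord.
Qed.

Lemma has_tderive_unitmx_near n (A : R -> 'M[Cx R]_n) t (A' : 'M[Cx R]_n) :
  A t \in unitmx -> has_tderive A t A' -> \forall s \near t, A s \in unitmx.
Proof.
rewrite unitmxE unitfE => At hA.
have /cvgr_neq0 := has_tderive_continuous (has_tderive_det hA).
by move=> /(_ At); apply: filterS => s; rewrite unitmxE unitfE.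
Qed.

(** Cramer's rule shows that some derivative [D] exists; differentiating [invmx (A s) *m A s], which
    is constant near [t], then identifies [D]. *)
Lemma has_tderive_invmx n (A : R -> 'M[Cx R]_n) t (A' : 'M[Cx R]_n) :
  A t \in unitmx -> has_tderive A t A' ->
  has_tderive (fun s => invmx (A s)) t (- (invmx (A t) *m A' *m invmx (A t))).
Proof.
move=> At hA; have nearU := has_tderive_unitmx_near At hA.
have [D hD] : exists D : 'M[Cx R]_n, has_tderive (fun s => invmx (A s)) t D.
  have [B hB] := tderivable_adj hA.
  have dt : \det (A t) != 0 by move: At; rewrite unitmxE unitfE.
  have hI := has_tderiveV dt (has_tderive_det hA).
  eexists; apply: has_tderive_near (has_tderiveZ hI hB).
  by move: nearU; apply: filterS => s; rewrite /invmx => ->.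
have h1 := has_tderive_mulmx hD hA.
have h0 : has_tderive (fun s => invmx (A s) *m A s) t 0.
  apply: has_tderive_near (has_tderive_cst 1%:M t).
  by move: nearU; apply: filterS => s; exact: mulVmx.
have [_ e1] := has_tderiveE h1; have [_ e0] := has_tderiveE h0.
have e : D *m A t + invmx (A t) *m A' = 0 by rewrite -e1 e0.
by rewrite -(invmx_derivative_eq At e).
Qed.

End Calculus.

(** * Matrix identities for the scattering matrix at a fixed spectral parameter *)

Section ScatteringAlgebra.
Context {C : numClosedFieldType}.

Lemma trmxCM m n p (A : 'M[C]_(m, n)) (B : 'M[C]_(n, p)) :
  (A *m B) ^t* = B ^t* *m A ^t*.
Proof. by rewrite trmx_mul map_mxM. Qed.

Lemma trmxCD m n (A B : 'M[C]_(m, n)) : (A + B) ^t* = A ^t* + B ^t*.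
Proof. by rewrite linearD map_mxD. Qed.

Lemma trmxCB m n (A B : 'M[C]_(m, n)) : (A - B) ^t* = A ^t* - B ^t*.
Proof. by rewrite linearB map_mxB. Qed.

Lemma trmxCZ m n (c : C) (A : 'M[C]_(m, n)) : (c *: A) ^t* = c^* *: A ^t*.
Proof. by rewrite linearZ map_mxZ. Qed.

Lemma trmxC_scalar n (c : C) : (c%:M : 'M[C]_n) ^t* = c^*%:M.
Proof. by rewrite tr_scalar_mx map_scalar_mx. Qed.

Lemma trmxC1 n : (1%:M : 'M[C]_n) ^t* = 1%:M.
Proof. by rewrite trmxC_scalar conjC1. Qed.

Context {d r : nat} (F : 'M[C]_d) (V : 'M[C]_(d, r)) (k : C).
Hypothesis uF : F \in unitmx.
Hypothesis kI : k^* = - k.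
Hypothesis FB : F - F ^t* = k *: (V *m V ^t*).

Let G := invmx F.
Let X := V ^t* *m G *m V.
Let Y := V ^t* *m G ^t* *m V.
Let S := - 1%:M + k *: X.

Lemma adj_X : X ^t* = Y.
Proof. by rewrite /X !trmxCM trmxCK mulmxA. Qed.

Lemma adj_S : S ^t* = - 1%:M - k *: Y.
Proof.
by rewrite /S trmxCD trmxCZ adj_X kI scaleNr linearN map_mxN trmxC1.
Qed.

(** A resolvent identity: sandwich F - F^* between G^* and G. *)
Lemma resolvent_diff : k *: (G ^t* *m (V *m V ^t*) *m G) = G ^t* - G.
Proof.
rewrite scalemxAl scalemxAr -FB mulmxBr mulmxBl -mulmxA mulmxV // mulmx1.
by rewrite -trmxCM mulmxV // trmxC1 mul1mx.
Qed.

Lemma mul_YX : k *: (Y *m X) = Y - X.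
Proof.
have -> : Y *m X = V ^t* *m (G ^t* *m (V *m V ^t*) *m G) *m V.
  by rewrite /X /Y !mulmxA.
by rewrite scalemxAl scalemxAr resolvent_diff mulmxBr mulmxBl.
Qed.

Lemma adj_S_row : S ^t* *m (V ^t* *m G) = - (V ^t* *m G ^t*).
Proof.
rewrite adj_S mulmxBl mulNmx mul1mx -scalemxAl.
have -> : Y *m (V ^t* *m G) = V ^t* *m (G ^t* *m (V *m V ^t*) *m G).
  by rewrite /Y !mulmxA.
by rewrite scalemxAr resolvent_diff mulmxBr opprB addrA addNr add0r.
Qed.

Lemma adj_S_X : S ^t* *m X = - Y.
Proof.
have -> : S ^t* *m X = S ^t* *m (V ^t* *m G) *m V by rewrite -mulmxA.
by rewrite adj_S_row mulNmx.
Qed.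

Lemma S_unitary : S ^t* *m S = 1%:M.
Proof.
rewrite {2}/S mulmxDr mulmxN mulmx1 -scalemxAr adj_S_X adj_S.
by rewrite scalerN opprB opprK [k *: Y + _]addrC addrK.
Qed.

(** The factor multiplied by S^* is the angular derivative of S: its first term is k' X, and its
    second is - k V^* G F' G V, the middle matrix being F'. *)
Lemma S_log_derivative (a z : C) : a != 0 -> z != 0 -> k = (z^-1 - z) / a ->
  'i *: (S ^t* *m (('i * - (z + z^-1) / a) *: X
      - k *: (V ^t* *m (G *m (('i * a ^+ 2 * k)%:M - ('i * z^-1 / a) *: (V *m V ^t*)) *m G) *m V)))
  = - (z^-1 - z) ^+ 2 *: (V ^t* *m G ^t* *m G *m V) - a^-1 *: (z^-1 *: X + z *: Y).
Proof.
move=> a0 z0 kE; set Z := V ^t* *m G ^t* *m G *m V.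
set c := 'i * a ^+ 2 * k; set e := 'i * z^-1 / a.
have -> : S ^t* *m (('i * - (z + z^-1) / a) *: X
      - k *: (V ^t* *m (G *m (c%:M - e *: (V *m V ^t*)) *m G) *m V)) =
    - (('i * - (z + z^-1) / a) *: Y) + k *: (c *: Z - e *: (Y *m X)).
  rewrite mulmxBr -!scalemxAr adj_S_X scalerN.
  congr (_ + _); rewrite -scalerN; congr (_ *: _).
  (* S^* turns the leftmost G into - G^*; this is how Z and Y X arise. *)
  rewrite !mulmxA -(mulmxA (S ^t*)) adj_S_row !mulNmx opprK.
  rewrite mulmxBr !mulmxBl mul_mx_scalar -!scalemxAl -!scalemxAr -!scalemxAl.
  by rewrite /Z /Y /X !mulmxA.
have PE : k *: (Y *m X) = Y - X by exact: mul_YX.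
have -> : k *: (c *: Z - e *: (Y *m X)) = (k * c) *: Z - e *: (Y - X).
  by rewrite scalerBr scalerA !scalerA (mulrC k e) -[in RHS]PE scalerA.
have i2 : 'i * 'i = -1 :> C by rewrite -expr2 sqrCi.
move: (X) (Y) Z => x y w; apply/matrixP => i j; rewrite !mxE.
rewrite /c /e kE; move: (x i j) (y i j) (w i j) => {}x {}y {}w.
set u := 'i : C in i2 *.
(* [field] sees [u] as a free symbol, so its square is isolated before it is replaced by -1. *)
transitivity ((u * u) * ((z + z^-1) / a * y + (z^-1 - z) ^+ 2 * w - z^-1 / a * (y - x))).
  by field; rewrite a0 z0.
by rewrite i2; field; rewrite a0 z0.
Qed.

End ScatteringAlgebra.

(** * The unit circle parametrized by [expi], and the derivatives of [expi] and its inverse *)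

Section Angles.
Context {R : realType}.
Implicit Types t : R.

Lemma expiE t : expi t = toC (cos t) + 'i * toC (sin t) :> Cx R.
Proof. by rewrite -complexiE; exact: complexE. Qed.

Lemma expiD t s : expi (t + s) = expi t * expi s :> Cx R.
Proof.
rewrite !expiE cosD sinD /toC rmorphB !rmorphD !rmorphM /=.
have i2 : 'i * 'i = -1 :> Cx R by rewrite -expr2 sqrCi.
set u := 'i : Cx R in i2 *.
move: (_ (cos t)) (_ (cos s)) (_ (sin t)) (_ (sin s)) => a b c e.
transitivity (a * b + (u * u) * (c * e) + u * (c * b + a * e)); last by ring.
by rewrite i2; ring.
Qed.

Lemma expi0 : expi 0 = 1 :> Cx R.
Proof. by rewrite expiE cos0 sin0 /toC rmorph0 mulr0 addr0 rmorph1. Qed.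

Lemma expi_mulN t : expi t * expi (- t) = 1 :> Cx R.
Proof. by rewrite -expiD subrr expi0. Qed.

Lemma expi_neq0 t : expi t != 0 :> Cx R.
Proof.
by apply/eqP => e; have /esym/eqP := expi_mulN t; rewrite e mul0r oner_eq0.
Qed.

Lemma expiN t : expi (- t) = (expi t)^-1 :> Cx R.
Proof. by apply: (mulfI (expi_neq0 t)); rewrite expi_mulN divff ?expi_neq0. Qed.

Lemma expi_conj t : (expi t)^* = (expi t)^-1 :> Cx R.
Proof. by rewrite -expiN /expi cosN sinN. Qed.

Lemma norm_expi t : `|expi t| = 1 :> Cx R.
Proof. by apply/eqP; rewrite -sqrp_eq1 ?normr_ge0 // normCK expi_conj divff ?expi_neq0. Qed.

Lemma expiX n t : expi (n%:R * t) = expi t ^+ n :> Cx R.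
Proof.
elim: n => [|n IH]; first by rewrite mul0r expi0 expr0.
by rewrite -natr1 mulrDl mul1r expiD IH exprSr.
Qed.

Lemma expiB_sin t : expi t - (expi t)^-1 = 2 * 'i * toC (sin t) :> Cx R.
Proof. by rewrite -expiN !expiE cosN sinN /toC rmorphN /=; ring. Qed.

Lemma expiD_cos t : expi t + (expi t)^-1 = 2 * toC (cos t) :> Cx R.
Proof. by rewrite -expiN !expiE cosN sinN /toC rmorphN /=; ring. Qed.

Lemma expi_neqV t : 0 < t < pi -> expi t - (expi t)^-1 != 0 :> Cx R.
Proof.
move=> /sin_gt0_pi s0; rewrite expiB_sin !mulf_neq0 ?neq0Ci ?pnatr_eq0 //.
by apply: toC_neq0; rewrite gt_eqF.
Qed.

Lemma has_tderive_toC (f : R -> R) t l : is_derive t 1 f l ->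
  has_tderive (fun s => toC (f s)) t (toC l).
Proof.
move=> [df fl]; move: df; rewrite /derivable => /cvg_ex[l' hl'].
have e : l' = l by rewrite -fl; apply/esym/cvg_lim => //; exact: hl'.
rewrite {}e in hl'; apply: cvg_near_ext (toC_cvg hl').
near=> h; rewrite /diff_quotient /= /GRing.scale /= mulr1 (addrC h).
by rewrite /toC rmorphM fmorphV rmorphB.
Unshelve. all: by end_near. Qed.

Lemma has_tderive_expi t : has_tderive (@expi R) t ('i * expi t).
Proof.
have -> : 'i * expi t = toC (- sin t) + 'i * toC (cos t) :> Cx R.
  by rewrite expiE mulrDr mulrA -expr2 sqrCi mulN1r addrC /toC rmorphN.
have -> : @expi R = (fun s => toC (cos s) + 'i * toC (sin s)).
  by apply/funext => s; exact: expiE.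
apply: has_tderiveD; first exact: has_tderive_toC.
by apply: has_tderiveMl; exact: has_tderive_toC.
Qed.

Lemma has_tderive_expiV t :
  has_tderive (fun s => (expi s)^-1 : Cx R) t (- 'i * (expi t)^-1).
Proof.
have := has_tderiveV (expi_neq0 t) (@has_tderive_expi t).
congr has_tderive; have := expi_neq0 t; set z := expi t => z0.
by field.
Qed.

End Angles.

(** * The scattering matrix along the unit circle, its derivative and the closed form of M *)

Section Scattering.
Context {R : realType}.

Lemma prime_power_gt1 q : is_prime_power q -> (1 < q)%N.
Proof.
move=> [p [k [pp k0 ->]]]; apply: leq_trans (prime_gt1 pp) _.
by rewrite -{1}(expn1 p) leq_exp2l // prime_gt1.
Qed.

Lemma aq_real q : (aq R q)^* = aq R q.
Proof. by apply: conj_Creal; rewrite /aq; apply/complex_realP; eexists. Qed.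

Lemma aq_sqr q : aq R q ^+ 2 = q%:R.
Proof. by rewrite /aq /toC -rmorphXn sqr_sqrtr ?ler0n // rmorph_nat. Qed.

Lemma aq_neq0 q : (0 < q)%N -> aq R q != 0.
Proof. by move=> q0; rewrite -sqrf_eq0 aq_sqr pnatr_eq0 -lt0n. Qed.

Lemma xq_real q (t : R) : (xq q (expi t))^* = xq q (expi t).
Proof. by rewrite /xq rmorphM rmorphD fmorphV /= aq_real expi_conj invrK [_^-1 + _]addrC. Qed.

Context {q d r : nat} (H : 'M[Cx R]_d) (V : 'M[Cx R]_(d, r)).

Lemma regular_anglesP t :
  regular_angles q H V t <-> 0 < t < pi /\ Fmx q H V (expi t) \in unitmx.
Proof.
rewrite unitmxE unitfE; split => [[t0 nT]|[t0 Ft]]; split => //.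
  by apply/eqP => Ft; apply: nT.
by move=> [_ Ft']; rewrite Ft' eqxx in Ft.
Qed.

Hypotheses (q_gt0 : (0 < q)%N) (hH : H = H ^t*).

Local Notation a := (aq R q).
Local Notation z t := (expi t : Cx R).
Local Notation k t := ((((z t)^-1 - z t) / a)).
Local Notation F t := (Fmx q H V (z t)).
Local Notation G t := (invmx (F t)).
Local Notation X t := (V ^t* *m G t *m V).
Local Notation Y t := (V ^t* *m (G t) ^t* *m V).
Local Notation Z t := (V ^t* *m (G t) ^t* *m G t *m V).
Local Notation S t := (Sth q H V t).

Lemma k_conj t : (k t)^* = - k t.
Proof.
rewrite rmorphM fmorphV rmorphB fmorphV /= !expi_conj aq_real invrK.
by rewrite -mulNr opprB.
Qed.

Lemma Fmx_adj t : F t - (F t) ^t* = k t *: (V *m V ^t*).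
Proof.
have cE : ((z t)^-1 / a)^* = z t / a.
  by rewrite rmorphM !fmorphV /= aq_real expi_conj invrK.
rewrite /Fmx trmxCD trmxCB trmxCZ trmxCM trmxCK -hH trmxC_scalar xq_real cE.
by rewrite opprD addrACA subrr add0r -scalerBl -mulrBl.
Qed.

Lemma Sth_unitary t : F t \in unitmx -> (S t) ^t* *m S t = 1%:M.
Proof. by move=> uF; exact: S_unitary uF (k_conj t) (Fmx_adj t). Qed.

Lemma has_tderiveZl n m (f : R -> Cx R) (A : 'M[Cx R]_(n, m)) t (l : Cx R) :
  has_tderive f t l -> has_tderive (fun s => f s *: A) t (l *: A).
Proof.
move=> fl; have := has_tderiveZ fl (@has_tderive_cst _ _ A t).
by rewrite scaler0 addr0.
Qed.

Lemma has_tderive_Fmx t : has_tderive (fun s => F s) t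
  (('i * a ^+ 2 * k t)%:M - ('i * (z t)^-1 / a) *: (V *m V ^t*)).
Proof.
have a0 := aq_neq0 q_gt0; have z0 := @expi_neq0 R t.
have -> : (fun s => F s) = (fun s => H + ((- a) * (z s + (z s)^-1)) *: 1%:M
    + (a^-1 * (z s)^-1) *: (V *m V ^t*)).
  by apply/funext => s; rewrite /Fmx scalemx1 mulNr raddfN mulrC.
have h1 := has_tderiveMl (c := - a) (has_tderiveD (@has_tderive_expi _ t) (@has_tderive_expiV _ t)).
have h2 := has_tderiveMl (c := a^-1) (@has_tderive_expiV _ t).
have := has_tderiveD (has_tderiveD (@has_tderive_cst _ _ H t)
  (has_tderiveZl (A := 1%:M : 'M[Cx R]_d) h1)) (has_tderiveZl (A := V *m V ^t*) h2).
congr has_tderive; rewrite add0r scalemx1; congr (_%:M + _).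
  by field; rewrite a0 z0.
by rewrite -scaleNr; congr (_ *: _); field; rewrite a0 z0.
Qed.

Lemma has_tderive_Sth t : F t \in unitmx -> has_tderive (Sth q H V) t
  (('i * - (z t + (z t)^-1) / a) *: X t
    - k t *: (V ^t* *m (G t *m (('i * a ^+ 2 * k t)%:M
                     - ('i * (z t)^-1 / a) *: (V *m V ^t*)) *m G t) *m V)).
Proof.
move=> uF; have a0 := aq_neq0 q_gt0; have z0 := @expi_neq0 R t.
have hG := has_tderive_invmx uF (@has_tderive_Fmx t).
have hX := has_tderive_mulmx (has_tderive_mulmx (@has_tderive_cst _ _ (V ^t*) t) hG)
  (@has_tderive_cst _ _ V t).
have hk := has_tderiveMl (c := a^-1) (has_tderiveD (@has_tderive_expiV _ t)
  (has_tderiveMl (c := -1) (@has_tderive_expi _ t))).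
have -> : Sth q H V = (fun s => - 1%:M + (a^-1 * ((z s)^-1 + -1 * z s)) *: X s).
  by apply/funext => s; rewrite /Sth /Smx mulN1r mulrC.
have := has_tderiveD (@has_tderive_cst _ _ (- 1%:M : 'M[Cx R]_r) t) (has_tderiveZ hk hX).
congr has_tderive; rewrite add0r mulmx0 addr0 mul0mx add0r.
congr (_ *: _ + _); first by field; rewrite a0 z0.
rewrite mulmxN mulNmx scalerN; congr (- (_ *: _)).
by rewrite mulN1r mulrC.
Qed.

Lemma MS_formula t : F t \in unitmx -> MS q H V t =
  - ((z t)^-1 - z t) ^+ 2 *: Z t - a^-1 *: ((z t)^-1 *: X t + z t *: Y t).
Proof.
move=> uF; have [_ hS] := has_tderiveE (has_tderive_Sth uF).
rewrite /MS hS.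
exact: (S_log_derivative uF (k_conj t) (Fmx_adj t) (aq_neq0 q_gt0) (@expi_neq0 R t) (erefl _)).
Qed.

(** In the closed form, X and Y are mutually adjoint, Z is self-adjoint, and conjugation exchanges z
    and z^-1, which fixes the square of z^-1 - z. *)
Lemma MS_adj t : F t \in unitmx -> (MS q H V t) ^t* = MS q H V t.
Proof.
move=> uF; rewrite MS_formula //.
have xy : (X t) ^t* = Y t by rewrite !trmxCM trmxCK mulmxA.
have yx : (Y t) ^t* = X t by rewrite -xy trmxCK.
have ww : (Z t) ^t* = Z t by rewrite !trmxCM !trmxCK !mulmxA.
move: (X t) (Y t) (Z t) xy yx ww => x y w xy yx ww.
rewrite trmxCB !trmxCZ trmxCD !trmxCZ xy yx ww.
rewrite rmorphN rmorphXn rmorphB !fmorphV /= expi_conj invrK aq_real.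
by rewrite -sqrrN opprB (addrC (z t *: y)).
Qed.

End Scattering.

(** * Truncated Gram matrices and the recovery formula *)

Section Gram.
Context {R : realType}.

Lemma dotc_mulmx m n (A B : 'M[Cx R]_(m, n)) i j :
  dotc (A *m delta_mx j 0) (B *m delta_mx i 0) = (B ^t* *m A) i j.
Proof.
rewrite -!colE mxE; apply: eq_bigr => l _.
by rewrite !mxE mulrC.
Qed.

(** The tail terms beyond N vanish, so the partial sums defining the limit are constant from N + 1
    on. *)
Lemma inner_PN d r N (w w' : state R d r) :
  inner (PN N w) w' = dotc w.1 w'.1 + \sum_(1 <= n < N.+1) dotc (w.2 n) (w'.2 n).
Proof.
rewrite /inner; congr (_ + _); apply: lim_near_cst; first exact: norm_hausdorff.
exists N.+1 => // K /= NK; rewrite (@big_cat_nat _ _ _ N.+1) //=.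
rewrite [X in _ + X]big_nat_cond [X in _ + X]big1 ?addr0; last first.
  move=> n /andP[/andP[Nn _] _]; rewrite [(n <= N)%N]leqNgt Nn andbF /dotc big1 // => i _.
  by rewrite mxE mul0r.
rewrite [LHS]big_nat [RHS]big_nat; apply: eq_bigr => n /andP[n1 nN].
by rewrite n1 -ltnS nN.
Qed.

Lemma inner_PN_gram d r N (P : 'cV[Cx R]_r -> state R d r) (A : 'M[Cx R]_(d, r))
    (B : nat -> 'M[Cx R]_r) i j :
  (forall alpha, (P alpha).1 = A *m alpha) ->
  (forall alpha n, (P alpha).2 n = B n *m alpha) ->
  inner (PN N (P (delta_mx j 0))) (P (delta_mx i 0)) =
  (A ^t* *m A + \sum_(1 <= n < N.+1) (B n) ^t* *m B n) i j.
Proof.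
move=> PA PB; rewrite inner_PN !PA dotc_mulmx [RHS]mxE summxE; congr (_ + _).
by apply: eq_bigr => n _; rewrite !PB dotc_mulmx.
Qed.

(** The factor w^-1 - w makes the sum telescope, each term becoming w^(2n-1) - w^(2n+1). The summand
    is kept as a product because [tail_gram] produces it so. *)
Lemma geometric_sqr (F : fieldType) (w : F) N : w != 0 ->
  (w^-1 - w) * (\sum_(1 <= n < N.+1) w ^+ n * w ^+ n) = w - w ^+ (2 * N + 1).
Proof.
move=> w0; elim: N => [|N IH]; first by rewrite big_geq // mulr0 expr1 subrr.
rewrite big_nat_recr //= mulrDr IH.
have -> : (2 * N.+1 + 1 = (N.+1 + N.+1).+1)%N by rewrite addn1 mul2n addnn.
have -> : (2 * N + 1 = (N + N).+1)%N by rewrite addn1 mul2n addnn.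
rewrite !exprS !exprD !exprS; by field.
Qed.

(** The incoming and outgoing waves contribute one identity matrix each, the latter by unitarity of
    S; the remaining two terms are their interference. *)
Lemma tail_gram (C : numClosedFieldType) r (w : C) (S : 'M[C]_r) n :
  w != 0 -> w^* = w^-1 -> S ^t* *m S = 1%:M ->
  let B := (w ^+ n)%:M + w^-1 ^+ n *: S in
  B ^t* *m B = 2%:M + (w^-1 ^+ n * w^-1 ^+ n) *: S + (w ^+ n * w ^+ n) *: S ^t*.
Proof.
move=> w0 wJ SS B; have zz : w ^+ n * w^-1 ^+ n = 1 by rewrite -exprMn divff // expr1n.
have -> : B ^t* = (w^-1 ^+ n)%:M + w ^+ n *: S ^t*.
  by rewrite trmxCD trmxC_scalar trmxCZ !rmorphXn fmorphV /= wJ invrK.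
rewrite /B mulmxDl !mulmxDr -scalar_mxM mul_scalar_mx mul_mx_scalar -!scalemxAl -!scalemxAr SS.
rewrite !scalerA (mulrC (w^-1 ^+ n) (w ^+ n)) zz scalemx1.
rewrite addrA addrC !addrA -raddfD addrAC; congr (_ + _ + _).
Qed.

Lemma Psi_tail q d r (H : 'M[Cx R]_d) (V : 'M[Cx R]_(d, r)) zeta alpha n :
  (Psi q H V zeta alpha).2 n =
  ((zeta ^+ n)%:M + zeta^-1 ^+ n *: Smx q H V zeta) *m alpha.
Proof. by rewrite [LHS]/= mulmxDl mul_scalar_mx -scalemxAl exprVn. Qed.

Lemma Psi_core q d r (H : 'M[Cx R]_d) (V : 'M[Cx R]_(d, r)) zeta alpha :
  (Psi q H V zeta alpha).1 =
  ((zeta^-1 - zeta) *: (invmx (Fmx q H V zeta) *m V)) *m alpha.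
Proof. by rewrite [LHS]/= -scalemxAl. Qed.

(** Gives the boundary prefactor the same denominator as the geometric sums. *)
Lemma i_div_2sin (t : R) : 0 < t < pi ->
  'i / toC (2 * sin t) = - (expi t - (expi t)^-1)^-1.
Proof.
move=> /expi_neqV; rewrite expiB_sin.
have -> : toC (2 * sin t) = 2 * toC (sin t) by rewrite toCE rmorphM rmorph_nat.
move: (toC (sin t)) => s h; have i2 : 'i * 'i = -1 :> Cx R by rewrite -expr2 sqrCi.
have : s != 0 by apply: contraNneq h => ->; rewrite mulr0.
move=> s0; apply: (mulIf h); rewrite mulNr mulVf // -i2.
by field.
Qed.

Context {q d r : nat} (H : 'M[Cx R]_d) (V : 'M[Cx R]_(d, r)).
Hypotheses (q_gt0 : (0 < q)%N) (hH : H = H ^t*).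

Local Notation a := (aq R q).
Local Notation z t := (expi t : Cx R).
Local Notation G t := (invmx (Fmx q H V (z t))).
Local Notation X t := (V ^t* *m G t *m V).
Local Notation Y t := (V ^t* *m (G t) ^t* *m V).
Local Notation Z t := (V ^t* *m (G t) ^t* *m G t *m V).
Local Notation S t := (Sth q H V t).

Lemma gram_expansion t N : Fmx q H V (z t) \in unitmx ->
  gram q H V t N = - ((z t)^-1 - z t) ^+ 2 *: Z t + ((2 * N)%:R)%:M
   + (\sum_(1 <= n < N.+1) (z t)^-1 ^+ n * (z t)^-1 ^+ n) *: S t
   + (\sum_(1 <= n < N.+1) z t ^+ n * z t ^+ n) *: (S t) ^t*.
Proof.
move=> uF; have z0 := @expi_neq0 R t.
pose A : 'M[Cx R]_(d, r) := ((z t)^-1 - z t) *: (G t *m V).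
pose B n := (z t ^+ n)%:M + (z t)^-1 ^+ n *: S t.
have gE : gram q H V t N = A ^t* *m A + \sum_(1 <= n < N.+1) (B n) ^t* *m B n.
  apply/matrixP => i j; rewrite mxE.
  by apply: inner_PN_gram => *; [exact: Psi_core | exact: Psi_tail].
have AE : A ^t* *m A = - ((z t)^-1 - z t) ^+ 2 *: Z t.
  rewrite /A trmxCZ trmxCM -scalemxAl -scalemxAr scalerA !mulmxA; congr (_ *: _).
  by rewrite rmorphB fmorphV /= expi_conj invrK -opprB mulNr expr2.
have BE n : (B n) ^t* *m B n = 2%:M + ((z t)^-1 ^+ n * (z t)^-1 ^+ n) *: S t
    + (z t ^+ n * z t ^+ n) *: (S t) ^t*.
  exact: (@tail_gram _ _ (z t) (S t) n z0 (expi_conj t) (Sth_unitary hH uF)).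
rewrite gE AE (eq_bigr _ (fun n _ => BE n)) !big_split /= -!scaler_suml !addrA.
congr (_ + _ + _ + _); rewrite big_const_nat subn1 /= iter_addr_0.
by rewrite -raddfMn -mulrnA.
Qed.

Lemma MS_gram t N : 0 < t < pi -> Fmx q H V (z t) \in unitmx ->
  MS q H V t = gram q H V t N - ((2 * N + 1)%:R)%:M - boundary q H V t N.
Proof.
move=> t0 uF; have z0 := @expi_neq0 R t; have zV := expi_neqV t0.
rewrite (MS_formula q_gt0 hH uF) (gram_expansion N uF).
have a0 : a != 0 := aq_neq0 q_gt0.
have := geometric_sqr N z0; have := geometric_sqr N (invr_neq0 z0); rewrite invrK.
(* Expressing S and S^* through X and Y makes the claim linear in X, Y and Z, so that it can be
   checked entry by entry. *)
have SE : S t = - 1%:M + (((z t)^-1 - z t) / a) *: X t by [].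
have SsE : (S t) ^t* = - 1%:M - (((z t)^-1 - z t) / a) *: Y t.
  exact: adj_S (k_conj t).
rewrite /boundary (i_div_2sin t0) expiN expiX SE SsE.
move: (X t) (Y t) (Z t) => x y w.
move: (\sum_(1 <= n < N.+1) (z t)^-1 ^+ n * _) => s1.
move: (\sum_(1 <= n < N.+1) z t ^+ n * _) => s2.
have uV' : (z t)^-1 - z t != 0 by rewrite -oppr_eq0 opprB.
have p0 := expf_neq0 (2 * N + 1) z0.
rewrite exprVn; move: (z t) (z t ^+ (2 * N + 1)) p0 z0 zV a0 uV'.
(* Both geometric sums are replaced by their closed forms; [p] is z^(2N+1). *)
move=> u p p0 u0 uV a0 uV' /(canRL (mulKf uV)) -> /(canRL (mulKf uV')) ->.
apply/matrixP => i j; rewrite !mxE.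
move: (x i j) (y i j) (w i j) => {}x {}y {}w.
move: (a) a0 (u^-1) uV uV' (p^-1) => b b0 v uV uV' p'.
rewrite natrD; move: (2 * N)%:R => m.
by case: (i == j); rewrite ?mulr1n ?mulr0n; field; rewrite uV uV' b0.
Qed.
End Gram.

(** * Cesaro means of oscillating terms, and linearity of the traceless part *)

Section Averages.
Context {R : realType}.

(** The geometric sums are bounded by 2 / |1 - w| uniformly in L, and are divided by L. *)
Lemma cesaro_unimodular (w : Cx R) : `|w| = 1 -> w != 1 ->
  (L%:R^-1 : Cx R) * \sum_(1 <= N < L.+1) w ^+ N @[L --> \oo] --> (0 : Cx R).
Proof.
move=> w1 wn1; have d0 : 1 - w != 0 by rewrite subr_eq0 eq_sym.
have sumE L : \sum_(1 <= N < L.+1) w ^+ N = (1 - w)^-1 * (w - w ^+ L.+1).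
  apply: (mulfI d0); rewrite mulVKf //; elim: L => [|L IH].
    by rewrite big_geq // mulr0 expr1 subrr.
  by rewrite big_nat_recr //= mulrDr IH mulrBl mul1r -exprS subrKA.
pose K := `|(1 - w)^-1| * 2.
have [x x0 xE] : exists2 x : R, 0 < x & K = toC x.
  by apply: posC_toC; rewrite mulr_gt0 // normr_gt0 invr_eq0.
apply/cvgr0Pnorm_lt => e /posC_toC[y y0 ->].
near=> L.
have L0 : (0 : R) < L%:R by rewrite ltr0n; near: L; exists 1%N.
apply: (@le_lt_trans _ _ (toC (L%:R^-1 * x))).
  have -> : toC (L%:R^-1 * x) = L%:R^-1 * K.
    by rewrite xE toCE rmorphM fmorphV rmorph_nat.
  rewrite normrM normfV normr_nat ler_wpM2l ?invr_ge0 ?ler0n // sumE normrM.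
  rewrite ler_wpM2l ?normr_ge0 //; apply: le_trans (ler_normB _ _) _.
  by rewrite normrX w1 expr1n; exact: lexx.
rewrite toC_lt mulrC ltr_pdivrMr // mulrC -ltr_pdivrMr //.
by near: L; exact: nbhs_infty_gtr.
Unshelve. all: by end_near. Qed.

(** Leaving [A] and [B] arbitrary lets the lemma serve both the boundary matrix and its traceless
    part. The phases are z^-1 and z times powers of z^-2 and z^2, neither of which is 1 inside (0,
    pi). *)
Lemma cesaro_boundary t n (M A B : 'M[Cx R]_n) (T : nat -> 'M[Cx R]_n) (c : Cx R) :
  0 < t < pi ->
  (forall N, (1 <= N)%N -> T N = M + c *:
     (expi (- ((2 * N + 1)%:R * t)) *: A - expi ((2 * N + 1)%:R * t) *: B)) ->
  (L%:R^-1 : Cx R) *: \sum_(1 <= N < L.+1) T N @[L --> \oo] --> M.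
Proof.
move=> t0 TE; pose z : Cx R := expi t.
have z0 : z != 0 := expi_neq0 t.
have z21 : z ^+ 2 != 1.
  apply: contraNneq (expi_neqV t0) => z2; rewrite subr_eq0 -/z.
  by apply/eqP; apply: (mulfI z0); rewrite -expr2 z2 divff.
have nz : `|z ^+ 2| = 1 by rewrite normrX norm_expi expr1n.
have nzV : `|z ^- 2| = 1 by rewrite normfV nz invr1.
have zV1 : z ^- 2 != 1 by rewrite -[1]invr1 (inj_eq invr_inj).
pose u (w : Cx R) L := (L%:R^-1 : Cx R) * \sum_(1 <= N < L.+1) w ^+ N.
have : M + c *: (((z^-1 * u (z ^- 2) L) *: A) - (z * u (z ^+ 2) L) *: B) @[L --> \oo]
    --> M + c *: ((z^-1 * 0) *: A - (z * 0) *: B).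
  apply: cvgD; first exact: cvg_cst.
  apply: cvgZr; apply: cvgB; apply: cvgZl; apply: cvgMr; exact: cesaro_unimodular.
rewrite !mulr0 !scale0r subrr scaler0 addr0; apply: cvg_near_ext.
near=> L.
have L0 : (L%:R : Cx R) != 0 by rewrite pnatr_eq0 -lt0n; near: L; exists 1%N.
have TE' : \sum_(1 <= N < L.+1) T N = \sum_(1 <= N < L.+1) (M + c *:
    ((z^-1 * (z ^- 2) ^+ N) *: A - (z * (z ^+ 2) ^+ N) *: B)).
  apply: eq_big_nat => N /andP[N1 _]; rewrite (TE N N1) expiN expiX -/z.
  by rewrite exprD expr1 exprM exprVn -invfM mulrC.
apply: esym; rewrite TE' big_split /= scalerDr big_const_nat subn1 /= iter_addr_0.
rewrite -[M *+ L](@scaler_nat (Cx R)) scalerA (mulVf L0) scale1r -scaler_sumr scalerA mulrC -scalerA sumrB.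
rewrite -!scaler_suml -!mulr_sumr scalerBr !scalerA.
by rewrite [in RHS]scalerBr !scalerA /u -!mulrA !(mulrCA L%:R^-1).
Unshelve. all: by end_near. Qed.

Lemma tracelessD n (A B : 'M[Cx R]_n) : traceless (A + B) = traceless A + traceless B.
Proof. by rewrite /traceless mxtraceD mulrDr raddfD opprD addrACA. Qed.

Lemma tracelessZ n c (A : 'M[Cx R]_n) : traceless (c *: A) = c *: traceless A.
Proof. by rewrite /traceless mxtraceZ mulrCA scalerBr scale_scalar_mx. Qed.

Lemma tracelessB n (A B : 'M[Cx R]_n) : traceless (A - B) = traceless A - traceless B.
Proof. by rewrite tracelessD -[- B]scaleN1r tracelessZ scaleN1r. Qed.

Lemma traceless_scalar n (c : Cx R) : (0 < n)%N -> traceless (c%:M : 'M[Cx R]_n) = 0.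
Proof.
move=> n0; rewrite /traceless mxtrace_scalar -[c *+ n]mulr_natl mulrA mulVf ?mul1r ?subrr //.
by rewrite pnatr_eq0 -lt0n.
Qed.

Lemma traceless1 (A : 'M[Cx R]_1) : traceless A = 0.
Proof.
apply/matrixP => i j; rewrite !mxE !ord1 /mxtrace big_ord1 invr1 mul1r.
by rewrite mulr1n subrr.
Qed.

End Averages.

(** * Local branches of the logarithm of a unimodular function *)

Section Logarithm.
Context {R : realType}.

Lemma sqr_Re_Im (w : Cx R) : `|w| = 1 -> complex.Re w ^+ 2 + complex.Im w ^+ 2 = 1.
Proof.
move=> w1; have : _ = (`|w| : Cx R) ^+ 2 := add_Re2_Im2 w.
by rewrite w1 expr1n => /(@complexI R).
Qed.

Lemma unimodular_expi (w : Cx R) : `|w| = 1 -> exists phi : R, expi phi = w.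
Proof.
move=> /sqr_Re_Im; case: w => a b /= ab1.
have a1 : -1 <= a <= 1.
  by rewrite -ler_norml -(@expr_le1 _ 2) // -normrX ger0_norm ?sqr_ge0 // -ab1 lerDl sqr_ge0.
have sE : sin (acos a) = `|b|.
  by rewrite sin_acos // -ab1 addrAC subrr add0r sqrtr_sqr.
have cE : cos (acos a) = a by apply: acosK; rewrite in_itv.
have [b0|b0] := leP 0 b.
  by exists (acos a); rewrite /expi cE sE ger0_norm.
by exists (- acos a); rewrite /expi cosN sinN cE sE ltr0_norm // opprK.
Qed.

(** On the right half of the circle the arcsine of the imaginary part is an argument; the strict
    bounds place it where [asin] is continuous. *)
Lemma expi_asin (w : Cx R) : `|w| = 1 -> 0 < complex.Re w ->
  -1 < complex.Im w < 1 /\ expi (asin (complex.Im w)) = w.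
Proof.
move=> /sqr_Re_Im; case: w => a b /= ab1 a0.
have b1 : -1 < b < 1.
  rewrite -ltr_norml -(@expr_lt1 _ 2) // -normrX ger0_norm ?sqr_ge0 // -ab1 ltrDr.
  by rewrite exprn_gt0.
split=> //; have b1' : -1 <= b <= 1 by case/andP: b1 => *; rewrite !ltW.
rewrite /expi cos_asin // asinK ?in_itv //.
by rewrite -ab1 addrK sqrtr_sqr gtr0_norm.
Qed.

Lemma cexp_i (phi : R) : cexp ('i * toC phi) = expi phi.
Proof.
rewrite -complexiE /cexp /= !mul0r !mulr0 subr0 mul1r add0r expR0.
by rewrite toCE rmorph1 mul1r.
Qed.

Lemma norm_cexp (w : Cx R) : `|cexp w| = toC (expR (complex.Re w)).
Proof. by rewrite normrM norm_expi mulr1 toC_norm ger0_norm ?expR_ge0. Qed.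

(** Dividing by [f t] brings nearby values to the right half of the circle, where [expi_asin]
    supplies a continuous argument; an argument [phi] of [f t] is then added. *)
Lemma log_branch_exists (f : R -> Cx R) t :
  (\forall s \near t, {for s, continuous f} /\ `|f s| = 1) ->
  exists l : R -> Cx R, is_log_branch l f t.
Proof.
move=> fP; have [ft nft] := nbhs_singleton fP.
have [phi phiE] := unimodular_expi nft.
have f0 : f t != 0 by rewrite -normr_eq0 nft oner_eq0.
pose g s := f s / f t.
exists (fun s => 'i * toC (phi + asin (complex.Im (g s)))).
have gt : g s @[s --> t] --> g t by apply: cvgMl.
have Reg : \forall s \near t, 0 < complex.Re (g s).
  apply: (cvgr_gt _ (Re_cvg gt)).
  by rewrite /g divff //= ltr01.
near=> s.
have [fs nfs] : {for s, continuous f} /\ `|f s| = 1 by near: s.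
have ng : `|g s| = 1 by rewrite normrM nfs normfV nft invr1 mulr1.
have Reg0 : 0 < complex.Re (g s) by near: s.
have [im1 gE] := expi_asin ng Reg0; split; last first.
  by rewrite cexp_i expiD phiE gE /g mulrC divfK.
have gs : g x @[x --> s] --> g s by apply: cvgMl.
apply: cvgMr; apply: toC_cvg; apply: cvgD; first exact: cvg_cst.
exact: (continuous_cvg _ (continuous_asin im1) (Im_cvg gs)).
Unshelve. all: by end_near. Qed.

(** Since |f| = 1, the branch is i times a real function. Its increment [delta] satisfies f(t + h) -
    f(t) = f(t) (e^(i delta) - 1), which is inverted to first order. *)
Lemma log_branch_derive (f l : R -> Cx R) t f' :
  (\forall s \near t, `|f s| = 1) -> has_tderive f t f' -> is_log_branch l f t ->
  has_tderive l t (f' / f t).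
Proof.
move=> nf hf hl.
have lE : \forall s \near t, l s = 'i * toC (complex.Im (l s)) /\ f s = expi (complex.Im (l s)).
  near=> s.
  have nfs : `|f s| = 1 by near: s.
  have [_ ls] : {for s, continuous l} /\ cexp (l s) = f s by near: s.
  have Re0 : complex.Re (l s) = 0.
    apply: expR_inj; rewrite expR0; apply: (@complexI R); rewrite -toCE -norm_cexp ls.
    exact: nfs.
  have e : l s = 'i * toC (complex.Im (l s)).
    by rewrite -complexiE {1}[l s]complexE Re0 rmorph0 add0r.
  by split=> //; rewrite -ls e cexp_i -e.
have [lt fE] := nbhs_singleton lE; have [cl _] := nbhs_singleton hl.
have f0 : f t != 0 by rewrite fE expi_neq0.
pose delta h := complex.Im (l (t + h)) - complex.Im (l t).
have delta0 : delta h @[h --> (0 : R)^'] --> (0 : R).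
  rewrite -[X in _ --> X](subrr (complex.Im (l t))); apply: cvgB; last exact: cvg_cst.
  apply: Im_cvg => A lA; exact: (near_dnbhs_shift (cl _ lA)).
(* [delta h] may vanish for h <> 0, so the quotient (e^(iy) - 1) / y is extended continuously by its
   limit at 0. *)
pose psi y : Cx R := if y == 0 then 'i else (toC y)^-1 * (expi y - 1).
have psi0 : psi y @[y --> (0 : R)] --> ('i : Cx R).
  have psi00 : psi 0 = 'i by rewrite /psi eqxx.
  have : psi y @[y --> (0 : R)] --> psi 0; last by rewrite psi00.
  apply/continuous_withinNx; rewrite psi00.
  have := @has_tderive_expi R 0; rewrite expi0 mulr1; apply: cvg_near_ext.
  near=> y; rewrite /psi ifN /diff_quotient; last by near: y; exact: nbhs_dnbhs_neq.
  by rewrite expi0 add0r.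
have psiE y : expi y - 1 = toC y * psi y.
  rewrite /psi; case: eqP => [->|/eqP y0]; first by rewrite expi0 subrr mul0r.
  by rewrite mulVKf // toC_neq0.
have psid : psi (delta h) @[h --> (0 : R)^'] --> ('i : Cx R) by exact: (cvg_comp _ _ delta0 psi0).
have i0 : 'i != 0 :> Cx R by exact: neq0Ci.
have -> : f' / f t = 'i * (f' * (f t * 'i)^-1) by rewrite invfM mulrCA (mulrCA 'i) divff // mulr1.
apply: cvg_near_ext (cvgMr (cvgM hf (cvgV (mulf_neq0 f0 i0) (cvgMr psid)))).
near=> h; rewrite /unstable.inv_fun /diff_quotient /=.
have h0 : toC h != 0 by apply: toC_neq0; near: h; exact: nbhs_dnbhs_neq.
have p0 : psi (delta h) != 0 by near: h; exact: (cvgr_neq0 _ psid).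
have [lh fh] : l (t + h) = 'i * toC (complex.Im (l (t + h))) /\
  f (t + h) = expi (complex.Im (l (t + h))) by near: h; exact: near_dnbhs_shift lE.
have -> : f (t + h) - f t = f t * (toC (delta h) * psi (delta h)).
  by rewrite -psiE mulrBr mulr1 {2}fE -expiD subrKC -fh.
have -> : l (t + h) - l t = 'i * toC (delta h).
  by rewrite lh lt -mulrBr !toCE /delta rmorphB.
by rewrite /GRing.scale /=; field; rewrite h0 p0 f0.
Unshelve. all: by end_near. Qed.

End Logarithm.

(** * The determinant of the scattering matrix and its logarithmic derivative *)

Section Determinant.
Context {R : realType} {q d r : nat} (H : 'M[Cx R]_d) (V : 'M[Cx R]_(d, r)).
Hypotheses (q_gt0 : (0 < q)%N) (hH : H = H ^t*).

Lemma norm_det_Sth t : Fmx q H V (expi t) \in unitmx -> `|\det (Sth q H V t)| = 1.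
Proof.
move=> uF; apply/eqP; rewrite -sqrp_eq1 ?normr_ge0 // normCK mulrC.
by rewrite -det_map_mx -det_tr map_trmx -det_mulmx (Sth_unitary hH uF) det1.
Qed.

(** Jacobi's formula involves the adjugate of S, which unitarity turns into det S times S^*. *)
Lemma has_tderive_det_Sth t : Fmx q H V (expi t) \in unitmx ->
  exists2 f', has_tderive (fun s => \det (Sth q H V s)) t f'
    & \tr (MS q H V t) = 'i * (f' / \det (Sth q H V t)).
Proof.
move=> uF; have hS := has_tderive_Sth q_gt0 uF; have [_ SE] := has_tderiveE hS.
rewrite -SE in hS; eexists; first exact: has_tderive_det hS.
rewrite /MS mxtraceZ; congr (_ * _).
have d0 : \det (Sth q H V t) != 0 by rewrite -normr_eq0 norm_det_Sth ?oner_eq0.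
have -> : \adj (Sth q H V t) = \det (Sth q H V t) *: (Sth q H V t) ^t*.
  rewrite -[LHS]mul1mx -(Sth_unitary hH uF) -mulmxA mul_mx_adj.
  by rewrite mul_mx_scalar.
by rewrite -scalemxAr mxtraceZ mulrAC divff // mul1r mxtrace_mulC.
Qed.

Lemma regular_angles_near t : regular_angles q H V t ->
  \forall s \near t, regular_angles q H V s.
Proof.
move=> /regular_anglesP[/andP[t0 tpi] uF].
have := has_tderive_unitmx_near uF (@has_tderive_Fmx R q d r H V q_gt0 t).
move=> uFs; near=> s; apply/regular_anglesP; split; last by near: s.
apply/andP; split; near: s; [exact: lt_nbhsr | exact: lt_nbhsl].
Unshelve. all: by end_near. Qed.

End Determinant.

(** * A scalar core coupled to a single channel j *)

Section SingleChannel.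
Context {R : realType}.

Lemma delta_mx_adj m n (i : 'I_m) (j : 'I_n) :
  (delta_mx i j : 'M[Cx R]_(m, n)) ^t* = delta_mx j i.
Proof. by rewrite trmx_delta map_delta_mx. Qed.

Lemma diag_delta n (c e : Cx R) (j : 'I_n) :
  c%:M + e *: delta_mx j j = diag_mx (\row_i (c + e * (i == j)%:R)).
Proof.
apply/matrixP => k l; rewrite !mxE.
have [->|kl] := eqVneq k l; last first.
  rewrite (_ : (k == j) && (l == j) = false) ?mulr0 ?addr0 //.
  by apply: contraNF kl => /andP[/eqP-> /eqP->].
by rewrite andbb !mulr1n.
Qed.

(** The value does not involve [j]: this is what hides the coupled channel from det S. *)
Lemma det_scalar_delta n (c e : Cx R) (j : 'I_n) :
  \det (c%:M + e *: delta_mx j j) = (c + e) * c ^+ n.-1.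
Proof.
rewrite diag_delta det_diag (bigD1 j) //= mxE eqxx mulr1; congr (_ * _).
rewrite (eq_bigr (fun _ => c)) => [|i /negbTE ij]; last by rewrite mxE ij mulr0 addr0.
by rewrite prodr_const cardC1 card_ord.
Qed.

Context {q d r : nat} (q_gt1 : (1 < q)%N) (h : R) (i0 : 'I_d) (j : 'I_r).

Local Notation a := (aq R q).
Local Notation z t := (expi t : Cx R).
Local Notation H := ((toC h)%:M : 'M[Cx R]_d).
Local Notation V := (delta_mx i0 j : 'M[Cx R]_(d, r)).
Local Notation f t := (toC h - xq q (z t) + (z t)^-1 / a).

Lemma scalar_toC_adj : H = H ^t*.
Proof. by rewrite trmxC_scalar conj_Creal //; apply/complex_realP; exists h. Qed.

Lemma Fmx_single_channel (zeta : Cx R) : Fmx q H V zeta =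
  (toC h - xq q zeta)%:M + (zeta^-1 / a) *: delta_mx i0 i0.
Proof. by rewrite /Fmx delta_mx_adj mul_delta_mx raddfB. Qed.

Lemma single_channel_conj t : (f t)^* = toC h - xq q (z t) + z t / a.
Proof.
have hR : (toC h)^* = toC h by apply: conj_Creal; apply/complex_realP; exists h.
rewrite rmorphD rmorphB /= hR xq_real rmorphM !fmorphV /=.
by rewrite aq_real expi_conj invrK.
Qed.

(** f and its conjugate differ only in the terms z^-1 / a and z / a, so f = 0 would force z =
    z^-1. *)
Lemma single_channel_neq0 t : 0 < t < pi -> f t != 0.
Proof.
move=> t0; have a0 : a != 0 := aq_neq0 (ltnW q_gt1).
apply: contraNneq (expi_neqV t0) => ft; have := single_channel_conj t.
rewrite ft rmorph0 -{1}ft => /addrI/(mulIf (invr_neq0 a0)) ->.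
by rewrite subrr.
Qed.

(** The range of [V] is the line spanned by the basis vector [i0], on which F acts as the scalar
    f. *)
Lemma invmx_single_channel t : 0 < t < pi -> Fmx q H V (z t) \in unitmx ->
  invmx (Fmx q H V (z t)) *m V = (f t)^-1 *: V.
Proof.
move=> t0 uF; apply: (canLR (mulKmx uF)).
rewrite -scalemxAr [in RHS]Fmx_single_channel mulmxDl mul_scalar_mx -scalemxAl mul_delta_mx.
by rewrite -scalerDl scalerA mulVf ?scale1r // single_channel_neq0.
Qed.

Lemma Sth_single_channel t : 0 < t < pi -> Fmx q H V (z t) \in unitmx ->
  Sth q H V t = (-1)%:M + (((z t)^-1 - z t) / a / f t) *: delta_mx j j.
Proof.
move=> t0 uF; rewrite /Sth /Smx -mulmxA (invmx_single_channel t0 uF).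
by rewrite -scalemxAr scalerA delta_mx_adj mul_delta_mx raddfN.
Qed.

(** In the closed form of M the squares (z + z^-1)^2 and - (z^-1 - z)^2 add up to the constant 4. *)
Lemma MS_single_channel t : 0 < t < pi -> Fmx q H V (z t) \in unitmx ->
  MS q H V t = ((4 - 2 / q%:R - toC (2 * h * cos t) / a) / (f t * (f t)^*)) *: delta_mx j j.
Proof.
move=> t0 uF; rewrite (MS_formula (ltnW q_gt1) scalar_toC_adj uF).
have GV := invmx_single_channel t0 uF; set G := invmx _ in GV *.
have VG : V ^t* *m G ^t* = ((f t)^*)^-1 *: delta_mx j i0.
  by rewrite -trmxCM GV trmxCZ delta_mx_adj fmorphV.
rewrite -(mulmxA _ G) -(mulmxA (V ^t*) G) VG GV delta_mx_adj -!scalemxAl -!scalemxAr mul_delta_mx.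
rewrite !scalerA -scalerDl scalerA -scalerBl; congr (_ *: _).
have f0 := single_channel_neq0 t0; have g0 : (f t)^* != 0 by rewrite fmorph_eq0.
have a0 : a != 0 := aq_neq0 (ltnW q_gt1).
have -> : toC (2 * h * cos t) = toC h * (z t + (z t)^-1).
  by rewrite expiD_cos !toCE !rmorphM rmorph_nat mulrCA mulrA.
rewrite -(@aq_sqr R q).
move: f0 g0; rewrite single_channel_conj /xq; have z0 := @expi_neq0 R t.
move: (z t) z0 (a) a0 (toC h) => u u0 b b0 k; set v := u^-1.
have uv : u * v = 1 by rewrite divff.
move: uv; move: (v) => {}v uv f0 g0.
(* Homogenizing the constants with [u * v = 1] makes the goal an identity in independent u, v. *)
have -> : 4 = 4 * (u * v) :> Cx R by rewrite uv mulr1.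
have -> : 2 / b ^+ 2 = (2 * (u * v)) / b ^+ 2 by rewrite uv mulr1.
have cden (w : Cx R) : (k - b * (u + v) + w / b) * b = (k - b * (u + v)) * b + w.
  by rewrite mulrDl divfK.
by field; rewrite b0 -!cden !mulf_neq0.
Qed.

End SingleChannel.

(** * Two couplings with equal scattering determinants and different traceless parts *)

Lemma regular_angles_ext (R : realType) (q d r r' : nat) (H H' : 'M[Cx R]_d)
    (V : 'M[Cx R]_(d, r)) (V' : 'M[Cx R]_(d, r')) :
  (forall zeta, Fmx q H V zeta = Fmx q H' V' zeta) ->
  regular_angles q H V = regular_angles q H' V'.
Proof.
by move=> /funext FE; rewrite /regular_angles /Theta_F FE.
Qed.

Lemma mxtrace_delta_diag (K : pzRingType) n (j : 'I_n) :
  \tr (delta_mx j j : 'M[K]_n) = 1.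
Proof.
rewrite /mxtrace (bigD1 j) //= mxE !eqxx big1 ?addr0 // => i /negbTE ij.
by rewrite mxE ij.
Qed.

Lemma four_sub_div_neq0 (K : numFieldType) q : (1 < q)%N -> 4 - 2 / q%:R != 0 :> K.
Proof.
move=> q1; apply: lt0r_neq0; rewrite subr_gt0 ltr_pdivrMr ?ltr0n ?(ltnW q1) //.
by rewrite -natrM ltr_nat (@leq_trans (4 * 1)) // leq_mul2l ltnW.
Qed.

Lemma det_Sth_not_MS0 (R : realType) (q d r : nat) (theta : R) :
  (1 < q)%N -> (1 <= d)%N -> (2 <= r)%N -> 0 < theta < pi ->
  exists (H1 H2 : 'M[Cx R]_d) (V1 V2 : 'M[Cx R]_(d, r)),
    [/\ H1 = H1 ^t* /\ H2 = H2 ^t*,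
        regular_angles q H1 V1 theta /\ regular_angles q H2 V2 theta,
        regular_angles q H1 V1 = regular_angles q H2 V2,
        (forall t : R, regular_angles q H1 V1 t ->
           \det (Sth q H1 V1 t) = \det (Sth q H2 V2 t))
      & MS0 q H1 V1 theta <> MS0 q H2 V2 theta].
Proof.
move=> q1 d0 r2 t0; pose i0 := Ordinal d0.
(* Any real h with h <> x(theta) and h * cos theta <> 2 a - 1 / a works. *)
pose h : R := (cos theta == 0)%:R.
pose j0 : 'I_r := Ordinal (ltnW r2); pose j1 : 'I_r := Ordinal r2.
pose H : 'M[Cx R]_d := (toC h)%:M.
pose V j : 'M[Cx R]_(d, r) := delta_mx i0 j.
have FE (zeta : Cx R) : Fmx q H (V j0) zeta = Fmx q H (V j1) zeta.
  by rewrite !Fmx_single_channel.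
have regE := regular_angles_ext FE.
have a0 := @aq_neq0 R q (ltnW q1).
have hc : h * cos theta = 0.
  by rewrite /h; case: eqP => [->|_]; rewrite ?mulr0 ?mul0r.
have uF j : Fmx q H (V j) (expi theta) \in unitmx.
  rewrite unitmxE unitfE Fmx_single_channel det_scalar_delta.
  apply: mulf_neq0; first exact (single_channel_neq0 q1 h t0).
  apply: expf_neq0.
  (* The factor h - x(theta) is 1 if cos theta = 0, and - 2 a cos theta otherwise. *)
  rewrite /xq expiD_cos subr_eq0 /h; have [->|c0] := eqVneq (cos theta) 0.
    by rewrite !toCE rmorph1 rmorph0 !mulr0 oner_eq0.
  rewrite [toC _](rmorph0 (real_complex R)) eq_sym; apply: mulf_neq0 a0 _.
  by apply: mulf_neq0 (toC_neq0 c0); rewrite pnatr_eq0.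
have [c c0 MSE] : exists2 c : Cx R, c != 0 &
    forall j, MS q H (V j) theta = c *: delta_mx j j.
  eexists; last by move=> j; exact: MS_single_channel q1 _ _ _ _ t0 (uF j).
  have -> : 2 * h * cos theta = 0 by rewrite -mulrA hc mulr0.
  have f0 := single_channel_neq0 q1 h t0.
  rewrite [toC _](rmorph0 (real_complex R)) mul0r subr0.
  move: (toC h - xq q (expi theta) + _) f0 => f f0.
  have fJ : f^* != 0 by rewrite conjC_eq0.
  apply: mulf_neq0; last exact: invr_neq0 (mulf_neq0 f0 fJ).
  exact: four_sub_div_neq0.
exists H, H, (V j0), (V j1); split; last 1 first.
(* Both matrix units have trace 1, so the scalar parts cancel and the entry at ([j0], [j0]) would
   give 1 = 0. *)
- rewrite /MS0 !MSE !tracelessZ => /(scalerI c0)/matrixP/(_ j0 j0).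
  rewrite !mxE !eqxx.
  rewrite !mxtrace_delta_diag => /addIr/eqP; by rewrite oner_eq0.
- by split; exact: scalar_toC_adj.
- by split; apply/regular_anglesP; split.
- exact: regE.
- move=> t /regular_anglesP[tpi ut].
  have ut1 : Fmx q H (V j1) (expi t) \in unitmx by rewrite -FE.
  rewrite (Sth_single_channel q1 tpi ut) (Sth_single_channel q1 tpi ut1).
  by rewrite !det_scalar_delta.
Qed.

(** * Gram recovery, averages, trace and traceless part at a regular angle *)

Theorem corollary2p8 (R : realType) (q d r : nat)
    (hq : is_prime_power q) (hd : (1 <= d)%N) (hr : (1 <= r)%N)
    (H : 'M[Cx R]_d) (V : 'M[Cx R]_(d, r)) (hH : H = H ^t*)
    (theta : R) (htheta : regular_angles q H V theta) :
  (* the derivative of S_theta exists and M(theta) is Hermitian *)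
  (tderivable (Sth q H V) theta /\ (MS q H V theta) ^t* = MS q H V theta)
  (* recovery from every truncated Gram matrix *)
  /\ (forall N : nat, (1 <= N)%N ->
        MS q H V theta
        = gram q H V theta N - ((2 * N + 1)%:R)%:M - boundary q H V theta N)
  (* averaged form, limit in M_r(C) *)
  /\ ((L%:R^-1 : Cx R) *:
        \sum_(1 <= N < L.+1) (gram q H V theta N - ((2 * N + 1)%:R)%:M)
        @[L --> \oo] --> MS q H V theta)
  (* trace identity, for local branches of the logarithm *)
  /\ ((exists l : R -> Cx R,
          is_log_branch l (fun t => \det (Sth q H V t)) theta)
      /\ (forall l : R -> Cx R,
          is_log_branch l (fun t => \det (Sth q H V t)) theta ->
          tderivable l theta /\ \tr (MS q H V theta) = 'i * tderive l theta))
  (* det S determines the trace of M(theta) *)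
  /\ (forall (d' : nat) (H' : 'M[Cx R]_d') (V' : 'M[Cx R]_(d', r)),
        (1 <= d')%N -> H' = H' ^t* -> regular_angles q H' V' theta ->
        (\forall t \near theta, \det (Sth q H' V' t) = \det (Sth q H V t)) ->
        \tr (MS q H' V' theta) = \tr (MS q H V theta))
  (* for r >= 2, det S (on all angles) does not determine M_0(theta) *)
  /\ ((2 <= r)%N ->
        exists (H1 H2 : 'M[Cx R]_d) (V1 V2 : 'M[Cx R]_(d, r)),
          [/\ H1 = H1 ^t* /\ H2 = H2 ^t*,
              regular_angles q H1 V1 theta /\ regular_angles q H2 V2 theta,
              regular_angles q H1 V1 = regular_angles q H2 V2,
              (forall t : R, regular_angles q H1 V1 t ->
                 \det (Sth q H1 V1 t) = \det (Sth q H2 V2 t))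
            & MS0 q H1 V1 theta <> MS0 q H2 V2 theta])
  (* M_0(theta) is the traceless finite term of the truncated Gram matrix *)
  /\ (forall N : nat, (1 <= N)%N ->
        MS0 q H V theta
        = traceless (gram q H V theta N) - traceless (boundary q H V theta N))
  /\ ((L%:R^-1 : Cx R) *:
        \sum_(1 <= N < L.+1) traceless (gram q H V theta N)
        @[L --> \oo] --> MS0 q H V theta)
  (* for r = 1 the traceless part vanishes *)
  /\ (r = 1%N -> MS0 q H V theta = 0).
Proof.
have q1 := prime_power_gt1 hq; have q0 := ltnW q1.
have [t0 uF] := proj1 (regular_anglesP H V theta) htheta.
have gramE N : gram q H V theta N - ((2 * N + 1)%:R)%:M =
    MS q H V theta + boundary q H V theta N.
  by rewrite (MS_gram q0 hH N t0 uF) subrK.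
(* The universal term is a scalar matrix, hence disappears from the traceless part. *)
have gram0E N : traceless (gram q H V theta N) =
    MS0 q H V theta + traceless (boundary q H V theta N).
  rewrite /MS0 (MS_gram q0 hH N t0 uF) !tracelessB subrK.
  by rewrite (traceless_scalar _ hr) subr0.
have regs := regular_angles_near q0 htheta.
have [f' hf trE] := has_tderive_det_Sth q0 hH uF.
have nf : \forall s \near theta, `|\det (Sth q H V s)| = 1.
  by apply: filterS regs => s /regular_anglesP[_ us]; exact: norm_det_Sth.
split; [split|split; [|split; [|split; [|split; [|split; [|split; [|split]]]]]]].
- exact: (has_tderiveE (has_tderive_Sth q0 uF)).1.
- exact (MS_adj q0 hH uF).
- by move=> N _; exact (MS_gram q0 hH N t0 uF).
- by apply: cesaro_boundary t0 _ => N _; exact: gramE.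
- split.
    apply: log_branch_exists; apply: filterS regs => s /regular_anglesP[_ us].
    have [g' hg _] := has_tderive_det_Sth q0 hH us.
    by split; [exact: has_tderive_continuous hg | exact: norm_det_Sth].
  move=> l hl; have [dl ->] := has_tderiveE (log_branch_derive nf hf hl).
  by split.
- move=> d' H' V' _ hH' reg' detE.
  have [_ uF'] := proj1 (regular_anglesP H' V' theta) reg'.
  have [g' hg trE'] := has_tderive_det_Sth q0 hH' uF'.
  (* The trace depends only on the value and the derivative of the determinant at theta, and both
     agree for determinants equal near theta. *)
  have fg : g' = f'.
    exact (etrans (esym (has_tderiveE hg).2) (has_tderiveE (has_tderive_near detE hf)).2).
  have detE' := nbhs_singleton detE.
  rewrite fg in trE'; apply: (etrans trE'); apply: (etrans _ (esym trE)).
  exact (congr1 (fun x => 'i * (f' / x)) detE').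
- by move=> r2; exact: det_Sth_not_MS0 q1 hd r2 t0.
- by move=> N _; rewrite gram0E addrK.
- apply: (cesaro_boundary t0) => N _.
  by rewrite gram0E /boundary tracelessZ tracelessB !tracelessZ.
- move=> r1; move: V {htheta uF gramE gram0E regs f' hf trE nf}; rewrite {}r1 => V.
  exact: traceless1.
Qed.
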